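(* For $1\le k\le r$, we have $$\mathbf T_{\varpi_k}=(\mathbf T_0\mathbf T_1\cdots\mathbf T_{r-1}\mathbf T_r\mathbf T_{r-1}\cdots\mathbf T_k)^k.$$
   Context: **Setting.** Fix an integer $r\ge1$. Let $\mathbb I=\{0,1,\dots,2r\}$, $\mathbb I_0=\{1,\dots,2r\}$, and let $(c_{ij})_{i,j\in\mathbb I}$ be the affine Cartan matrix of type $A^{(1)}_{2r}$: $c_{ii}=2$, $c_{ij}=-1$ if $i-j\equiv\pm1\pmod{2r+1}$, $c_{ij}=0$ otherwise. Let $\tau$ be the involution of $\mathbb I$ with $\tau 0=0$, $\tau i=2r+1-i$ for $i\in\mathbb I_0$; thus $c_{0,\tau 0}=2$, $c_{i,\tau i}=-1$ for $i\in\{r,r+1\}$, $c_{i,\tau i}=0$ otherwise. Let $v$ be an indeterminate, $[n]=\frac{v^n-v^{-n}}{v-v^{-1}}$, $[a,b]_q=ab-q\,ba$, $[a,b]=[a,b]_1$. **The algebra $\widetilde{\mathbf U}^\imath$** (affine iquantum group of type AIII$_{2r}^{(\tau)}$) is the $\mathbb Q(v)$-algebra with generators $B_i,\mathbb K_i^{\pm1}$ ($i\in\mathbb I$) and relations: $\mathbb K_i\mathbb K_i^{-1}=\mathbb K_i^{-1}\mathbb K_i=1$; $\mathbb K_i\mathbb K_\ell=\mathbb K_\ell\mathbb K_i$; $\mathbb K_\ell B_i=v^{c_{\tau\ell,i}-c_{\ell i}}B_i\mathbb K_\ell$; $B_iB_j=B_jB_i$ if $c_{ij}=0$, $j\ne\tau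 i$; $B_i^2B_j-[2]B_iB_jB_i+B_jB_i^2=0$ if $c_{ij}=-1$, $j\neq\tau i\ne i$; $B_{\tau i}B_i-B_iB_{\tau i}=\frac{\mathbb K_i-\mathbb K_{\tau i}}{v-v^{-1}}$ if $c_{i,\tau i}=0$; $B_i^2B_j-[2]B_iB_jB_i+B_jB_i^2=-v^{-1}B_j\mathbb K_i$ if $c_{ij}=-1$, $\tau i=i$; $B_i^2B_{\tau i}-[2]B_iB_{\tau i}B_i+B_{\tau i}B_i^2=-[2](v\mathbb K_iB_i+vB_i\mathbb K_{\tau i})$ if $c_{i,\tau i}=-1$. **Symmetries.** The following known formulas define algebra automorphisms $\mathbf T_i$ ($0\le i\le r$) of $\widetilde{\mathbf U}^\imath$ satisfying the braid relations of the Coxeter group $W_\tau$ below; set $\mathbf T_{\tau i}=\mathbf T_i$. - $\mathbf T_0(\mathbb K_j)=\mathbb K_j\mathbb K_0^{-c_{0j}}$; $\mathbf T_0(B_0)=\mathbb K_0^{-1}B_0$; $\mathbf T_0(B_j)=B_jB_0-vB_0B_j$ if $c_{0j}=-1$; $\mathbf T_0(B_j)=B_j$ if $c_{0j}=0$. - For $1\le i\le r-1$: $\mathbf T_i(\mathbb K_j)=(-v)^{-c_{ij}-c_{\tau i,j}}\mathbb K_j\mathbb K_i^{-c_{ij}}\mathbb K_{\tau i}^{-c_{\tau i,j}}$; $\mathbf T_i(B_i)=-\mathbb K_i^{-1}B_{\tau i}$; $\mathbf T_i(B_{\tau i})=-\mathbb K_{\tau i}^{-1}B_i$; $\mathbf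 T_i(B_j)=B_jB_i-vB_iB_j$ if $(c_{ij},c_{\tau i,j})=(-1,0)$; $B_jB_{\tau i}-vB_{\tau i}B_j$ if $(c_{ij},c_{\tau i,j})=(0,-1)$; $[[B_j,B_i]_v,B_{\tau i}]_v-vB_j\mathbb K_i$ if $(c_{ij},c_{\tau i,j})=(-1,-1)$; $B_j$ otherwise. - For $i=r$: $\mathbf T_r(\mathbb K_j)=v^{-(c_{rj}+c_{r+1,j})}\mathbb K_j(\mathbb K_r\mathbb K_{r+1})^{-c_{rj}-c_{r+1,j}}$; $\mathbf T_r(B_r)=-v^{-2}B_r\mathbb K_{r+1}^{-1}$; $\mathbf T_r(B_{r+1})=-v^{-2}B_{r+1}\mathbb K_r^{-1}$; $\mathbf T_r(B_j)=[[B_j,B_r]_v,B_{r+1}]_v-\mathbb K_rB_j$ if $(c_{rj},c_{r+1,j})=(-1,0)$; $[[B_j,B_{r+1}]_v,B_r]_v-\mathbb K_{r+1}B_j$ if $(c_{rj},c_{r+1,j})=(0,-1)$; $v\big[[[B_j,B_r]_v,B_{r+1}],[B_{r+1},B_r]_v\big]-\big[B_j,[B_{r+1},B_r]_{v^3}\big]\mathbb K_r+vB_j\mathbb K_r\mathbb K_{r+1}$ if $(c_{rj},c_{r+1,j})=(-1,-1)$; $B_j$ otherwise. **Weyl groups.** Let $W=\langle s_i\mid i\in\mathbb I\rangle$ be the affine Weyl group acting on $\bigoplus_{i\in\mathbb I}\mathbb Z\alpha_i$ by $s_i\alpha_j=\alpha_j-c_{ij}\alpha_i$, and $\delta=\sum_{i\in\mathbb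 I}\alpha_i$. $W_\tau=\{w\in W\mid\tau w=w\tau\}$ is a Coxeter group with generators $\mathbf r_0=s_0$, $\mathbf r_i=s_is_{\tau i}$ ($1\le i\le r-1$), $\mathbf r_r=s_rs_{r+1}s_r$. For a reduced expression $w=\mathbf r_{i_1}\cdots\mathbf r_{i_k}$ in $W_\tau$, $\mathbf T_w=\mathbf T_{i_1}\cdots\mathbf T_{i_k}$. With $\omega_i$ ($i\in\mathbb I_0$) the fundamental weights of $\mathfrak{sl}_{2r+1}$ and $t_\omega$ the translation in the extended affine Weyl group, $t_\omega(\alpha_j)=\alpha_j-\langle\omega,\alpha_j\rangle\delta$ ($j\in\mathbb I_0$, $\langle\omega_i,\alpha_j\rangle=\delta_{ij}$), put $\varpi_i=t_{\omega_i}t_{\omega_{\tau i}}\in W_\tau$ for $i\in\mathbb I_0$. *)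

(* Defs.v *)
From HB Require Import structures.
From mathcomp Require Import all_boot all_order all_algebra.
From mathcomp Require Import boolp.

Set Implicit Arguments.
Unset Strict Implicit.
Unset Printing Implicit Defensive.

Import Order.TTheory GRing.Theory Num.Theory.
Local Open Scope ring_scope.

Definition Qv : fieldType := {fraction {poly rat}}.
Definition v : Qv := tofrac 'X.
Definition qint (n : int) : Qv := (v ^ n - v ^ (- n)) / (v - v^-1).

Notation aff r := 'I_(2 * r).+1.

Section AffineDatum.
Variable r : nat.

Definition cartan (i j : aff r) : int :=
  if i == j then 2
  else if (i == j.+1 %[mod (2 * r).+1]) || (j == i.+1 %[mod (2 * r).+1]) then -1
  else 0.

Definition tau (i : aff r) : aff r :=
  if i == 0%N :> nat then i else inord ((2 * r).+1 - i).

End AffineDatum.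

Definition qbracket (A : algType Qv) (q : Qv) (a b : A) : A :=
  a * b - q *: (b * a).

Definition qserre (A : algType Qv) (a b : A) : A :=
  a ^+ 2 * b - qint 2 *: (a * b * a) + b * a ^+ 2.

(* x ^ n for an element x with two-sided inverse y: the algebra below is not
   a unitRingType. *)
Definition zpow (A : algType Qv) (x y : A) (n : int) : A :=
  match n with Posz m => x ^+ m | Negz m => y ^+ m.+1 end.

(* K' i stands for the inverse of K i. *)
Record iquantum_relations (r : nat) (A : algType Qv) (B K K' : aff r -> A) :
    Prop := IquantumRelations {
  iq_KK' : forall i, K i * K' i = 1;
  iq_K'K : forall i, K' i * K i = 1;
  iq_KK : forall i l, K i * K l = K l * K i;
  iq_KB : forall l i,
    K l * B i = v ^ (cartan (tau l) i - cartan l i) *: (B i * K l);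
  iq_BB : forall i j, cartan i j = 0 -> j <> tau i -> B i * B j = B j * B i;
  iq_serre : forall i j, cartan i j = -1 -> j <> tau i -> tau i <> i ->
    qserre (B i) (B j) = 0;
  iq_BB_tau : forall i, cartan i (tau i) = 0 ->
    B (tau i) * B i - B i * B (tau i) = (v - v^-1)^-1 *: (K i - K (tau i));
  iq_serre_fix : forall i j, cartan i j = -1 -> tau i = i ->
    qserre (B i) (B j) = - (v^-1 *: (B j * K i));
  iq_serre_tau : forall i, cartan i (tau i) = -1 ->
    qserre (B i) (B (tau i)) =
      - (qint 2 *: (v *: (K i * B i) + v *: (B i * K (tau i))))
}.

(* The algebra presented by [iquantum_relations]: noncommutative polynomial
   expressions in the generators, two of them being identified when they take
   the same value at every family satisfying the relations in some
   Q(v)-algebra.  Lemmas [iqaffP], [iqlift_gen] and [iqlift_unique]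
   give its universal property. *)
Inductive iqterm (r : nat) : Type :=
| TB of aff r | TK of aff r | TK' of aff r
| TC of Qv | TAdd of iqterm r & iqterm r | TMul of iqterm r & iqterm r.
Arguments TC {r} _.

HB.instance Definition _ (r : nat) := gen_eqMixin (iqterm r).
HB.instance Definition _ (r : nat) := gen_choiceMixin (iqterm r).

Fixpoint iqeval (r : nat) (A : algType Qv) (B K K' : aff r -> A)
    (t : iqterm r) : A :=
  match t with
  | TB i => B i
  | TK i => K i
  | TK' i => K' i
  | TC c => c%:A
  | TAdd t1 t2 => iqeval B K K' t1 + iqeval B K K' t2
  | TMul t1 t2 => iqeval B K K' t1 * iqeval B K K' t2
  end.

Section Presentation.
Variable r : nat.

Definition iqequiv_prop (s t : iqterm r) : Prop :=
  forall (A : algType Qv) (B K K' : aff r -> A),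
    iquantum_relations B K K' -> iqeval B K K' s = iqeval B K K' t.

Definition iqequiv (s t : iqterm r) : bool := `[< iqequiv_prop s t >].

Lemma iqequiv_refl : reflexive iqequiv.
Proof. by move=> s; apply/asboolP. Qed.

Lemma iqequiv_sym : symmetric iqequiv.
Proof.
move=> s t; apply/asboolP/asboolP => h A B K K' rel; symmetry; exact: h.
Qed.

Lemma iqequiv_trans : transitive iqequiv.
Proof.
move=> t s u /asboolP h1 /asboolP h2; apply/asboolP => A B K K' rel.
by rewrite h1 // h2.
Qed.

Canonical iqequiv_equiv :=
  EquivRel iqequiv iqequiv_refl iqequiv_sym iqequiv_trans.

Definition iqaff : Type := {eq_quot iqequiv}%qT.
HB.instance Definition _ := Choice.on iqaff.
HB.instance Definition _ : EqQuotient (iqterm r) iqequiv iqaff :=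
  EqQuotient.on iqaff.

Local Notation pi := (\pi_iqaff%qT).

Lemma iqpiP (s t : iqterm r) : pi s = pi t <-> iqequiv_prop s t.
Proof. by split=> [/eqmodP/asboolP|h] //; apply/eqmodP/asboolP. Qed.

Definition iqval (A : algType Qv) (B K K' : aff r -> A) (x : iqaff) : A :=
  iqeval B K K' (repr x).

Lemma iqval_pi (A : algType Qv) (B K K' : aff r -> A) (t : iqterm r) :
  iquantum_relations B K K' -> iqval B K K' (pi t) = iqeval B K K' t.
Proof. by apply: (iqpiP _ _).1; rewrite reprK. Qed.

Lemma iqval_inj (x y : iqaff) :
  (forall (A : algType Qv) (B K K' : aff r -> A),
    iquantum_relations B K K' -> iqval B K K' x = iqval B K K' y) -> x = y.
Proof. by move=> h; rewrite -[x]reprK -[y]reprK; apply/iqpiP. Qed.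

Definition iqadd (x y : iqaff) : iqaff := pi (TAdd (repr x) (repr y)).
Definition iqmul (x y : iqaff) : iqaff := pi (TMul (repr x) (repr y)).
Definition iqcst (c : Qv) : iqaff := pi (TC c).
Definition iqopp (x : iqaff) : iqaff := iqmul (iqcst (-1)) x.
Definition iqscale (c : Qv) (x : iqaff) : iqaff := iqmul (iqcst c) x.

Section Eval.
Variables (A : algType Qv) (B K K' : aff r -> A).
Hypothesis rel : iquantum_relations B K K'.
Let val := iqval B K K'.

Lemma iqval_add x y : val (iqadd x y) = val x + val y.
Proof. by rewrite /val iqval_pi. Qed.
Lemma iqval_mul x y : val (iqmul x y) = val x * val y.
Proof. by rewrite /val iqval_pi. Qed.
Lemma iqval_cst c : val (iqcst c) = c%:A.
Proof. by rewrite /val iqval_pi. Qed.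
Lemma iqval_opp x : val (iqopp x) = - val x.
Proof. by rewrite iqval_mul iqval_cst scaleN1r mulN1r. Qed.
Lemma iqval_scale c x : val (iqscale c x) = c *: val x.
Proof. by rewrite iqval_mul iqval_cst mulr_algl. Qed.

Definition iqvalE := (iqval_add, iqval_opp, iqval_scale, iqval_mul, iqval_cst).
End Eval.

Ltac iqsolve :=
  let h := fresh "h" in apply: iqval_inj => ? ? ? ? h; rewrite !(iqvalE h).

Fact iqaddA : associative iqadd.
Proof. by move=> x y z; iqsolve; rewrite addrA. Qed.
Fact iqaddC : commutative iqadd.
Proof. by move=> x y; iqsolve; rewrite addrC. Qed.
Fact iqadd0 : left_id (iqcst 0) iqadd.
Proof. by move=> x; iqsolve; rewrite scale0r add0r. Qed.
Fact iqaddN : left_inverse (iqcst 0) iqopp iqadd.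
Proof. by move=> x; iqsolve; rewrite addNr scale0r. Qed.
Fact iqmulA : associative iqmul.
Proof. by move=> x y z; iqsolve; rewrite mulrA. Qed.
Fact iqmul1l : left_id (iqcst 1) iqmul.
Proof. by move=> x; iqsolve; rewrite scale1r mul1r. Qed.
Fact iqmul1r : right_id (iqcst 1) iqmul.
Proof. by move=> x; iqsolve; rewrite scale1r mulr1. Qed.
Fact iqmulDl : left_distributive iqmul iqadd.
Proof. by move=> x y z; iqsolve; rewrite mulrDl. Qed.
Fact iqmulDr : right_distributive iqmul iqadd.
Proof. by move=> x y z; iqsolve; rewrite mulrDr. Qed.

(* B |-> 0, K |-> 1 satisfies the relations. *)
Fact iq_trivial_rep :
  @iquantum_relations r Qv^o (fun=> 0) (fun=> 1) (fun=> 1).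
Proof.
split=> *; rewrite /qserre ?(mulr1, mulr0, mul0r, expr0n, scaler0, subrr) //=;
  by rewrite ?(mulr0, mul0r, scaler0, subr0, addr0, oppr0).
Qed.

Fact iqone_neq0 : iqcst 1 != iqcst 0.
Proof.
apply/eqP => /iqpiP /(_ _ _ _ _ iq_trivial_rep) /= /eqP.
by rewrite scale1r scale0r oner_eq0.
Qed.

HB.instance Definition _ := GRing.isZmodule.Build iqaff
  iqaddA iqaddC iqadd0 iqaddN.
HB.instance Definition _ := GRing.Zmodule_isNzRing.Build iqaff
  iqmulA iqmul1l iqmul1r iqmulDl iqmulDr iqone_neq0.

Fact iqscaleA a b (x : iqaff) : iqscale a (iqscale b x) = iqscale (a * b) x.
Proof. by iqsolve; rewrite scalerA. Qed.
Fact iqscale1 : left_id 1 iqscale.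
Proof. by move=> x; iqsolve; rewrite scale1r. Qed.
Fact iqscaleDr : right_distributive iqscale iqadd.
Proof. by move=> a x y; iqsolve; rewrite scalerDr. Qed.
Fact iqscaleDl (x : iqaff) :
  {morph iqscale^~ x : a b / a + b >-> iqadd a b}.
Proof. by move=> a b; iqsolve; rewrite scalerDl. Qed.

HB.instance Definition _ := GRing.Zmodule_isLmodule.Build Qv iqaff
  iqscaleA iqscale1 iqscaleDr iqscaleDl.

Fact iqscaleAl a (x y : iqaff) :
  iqscale a (iqmul x y) = iqmul (iqscale a x) y.
Proof. by iqsolve; rewrite scalerAl. Qed.
HB.instance Definition _ := GRing.Lmodule_isLalgebra.Build Qv iqaff iqscaleAl.

Fact iqscaleAr a (x y : iqaff) :
  iqscale a (iqmul x y) = iqmul x (iqscale a y).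
Proof. by iqsolve; rewrite scalerAr. Qed.
HB.instance Definition _ := GRing.Lalgebra_isAlgebra.Build Qv iqaff iqscaleAr.

Definition Bgen (i : aff r) : iqaff := pi (TB i).
Definition Kgen (i : aff r) : iqaff := pi (TK i).
Definition K'gen (i : aff r) : iqaff := pi (TK' i).

Section Lift.
Variables (A : algType Qv) (B K K' : aff r -> A).
Hypothesis rel : iquantum_relations B K K'.

Definition iqlift of iquantum_relations B K K' : iqaff -> A := iqval B K K'.

Fact iqlift_is_zmod_morphism : zmod_morphism (iqlift rel).
Proof. by move=> x y; rewrite [LHS](iqval_add rel) (iqval_opp rel). Qed.
Fact iqlift_is_monoid_morphism : monoid_morphism (iqlift rel).
Proof.
by split=> [|x y]; [rewrite [LHS](iqval_cst rel) scale1r|exact: iqval_mul].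
Qed.
Fact iqlift_is_scalable : scalable (iqlift rel).
Proof. by move=> a x; apply: iqval_scale. Qed.

HB.instance Definition _ := GRing.isZmodMorphism.Build iqaff A (iqlift rel)
  iqlift_is_zmod_morphism.
HB.instance Definition _ := GRing.isMonoidMorphism.Build iqaff A (iqlift rel)
  iqlift_is_monoid_morphism.
HB.instance Definition _ := GRing.isScalable.Build Qv iqaff A *:%R
  (iqlift rel) iqlift_is_scalable.

Lemma iqlift_B i : iqlift rel (Bgen i) = B i.
Proof. exact: (iqval_pi _ rel). Qed.
Lemma iqlift_K i : iqlift rel (Kgen i) = K i.
Proof. exact: (iqval_pi _ rel). Qed.
Lemma iqlift_K' i : iqlift rel (K'gen i) = K' i.
Proof. exact: (iqval_pi _ rel). Qed.
Definition iqlift_gen := (iqlift_B, iqlift_K, iqlift_K').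

Lemma iqlift_unique (f : {lrmorphism iqaff -> A}) :
  (forall i, f (Bgen i) = B i) -> (forall i, f (Kgen i) = K i) ->
  (forall i, f (K'gen i) = K' i) -> f =1 iqlift rel.
Proof.
move=> fB fK fK' x; rewrite -[x]reprK [RHS](iqval_pi _ rel).
elim: (repr x) => [i|i|i|c|s IHs t IHt|s IHs t IHt] /=;
  [exact: fB|exact: fK|exact: fK'| | |].
- have -> : pi (TC c) = c *: (1 : iqaff).
    by apply: iqval_inj => ? ? ? ? h; rewrite iqval_pi // (iqval_scale h)
      (iqval_cst h) scale1r.
  by rewrite linearZ rmorph1.
- have -> : pi (TAdd s t) = pi s + pi t :> iqaff.
    by apply: iqval_inj => ? ? ? ? h; rewrite (iqval_add h) !iqval_pi.
  by rewrite rmorphD; congr (_ + _); [exact: IHs|exact: IHt].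
- have -> : pi (TMul s t) = pi s * pi t :> iqaff.
    by apply: iqval_inj => ? ? ? ? h; rewrite (iqval_mul h) !iqval_pi.
  by rewrite rmorphM; congr (_ * _); [exact: IHs|exact: IHt].
Qed.
End Lift.

Lemma lrmorph_qserre (A1 A2 : algType Qv) (f : {lrmorphism A1 -> A2}) a b :
  f (qserre a b) = qserre (f a) (f b).
Proof.
by rewrite /qserre !expr2 linearD linearB linearZ /= !rmorphM.
Qed.

Lemma iqaffP : iquantum_relations Bgen Kgen K'gen.
Proof.
have ext (x y : iqaff) : (forall (A : algType Qv) (B K K' : aff r -> A)
    (h : iquantum_relations B K K'), iqlift h x = iqlift h y) -> x = y.
  by move=> h; apply: iqval_inj => A B K K' rel; apply: (h A B K K' rel).
split=> [i|i|i l|l i|i j cij ij|i j cij ij i_i|i ci|i j cij i_i|i ci];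
  apply: ext => A B K K' h; rewrite ?lrmorph_qserre ?linear0.
- by rewrite rmorphM rmorph1 /= !iqlift_gen (iq_KK' h).
- by rewrite rmorphM rmorph1 /= !iqlift_gen (iq_K'K h).
- by rewrite !rmorphM /= !iqlift_gen (iq_KK h).
- by rewrite linearZ /= !rmorphM /= !iqlift_gen (iq_KB h).
- by rewrite !rmorphM /= !iqlift_gen (iq_BB h).
- by rewrite /= !iqlift_gen (iq_serre h).
- by rewrite linearZ /= !rmorphB !rmorphM /= !iqlift_gen (iq_BB_tau h).
- by rewrite linearN linearZ /= rmorphM /= !iqlift_gen (iq_serre_fix h).
- rewrite linearN linearZ linearD !linearZ !rmorphM /= !iqlift_gen.
  by rewrite scalerN (iq_serre_tau h).
Qed.

End Presentation.

Section Symmetries.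
Variable r : nat.
Local Notation U := (iqaff r).
Local Notation B := (@Bgen r).
Local Notation K := (@Kgen r).
Local Notation K' := (@K'gen r).
Local Notation c := (@cartan r).

Definition T0_K (j : aff r) : U :=
  K j * zpow (K ord0) (K' ord0) (- c ord0 j).

Definition T0_B (j : aff r) : U :=
  if j == ord0 then K' ord0 * B ord0
  else if c ord0 j == -1 then B j * B ord0 - v *: (B ord0 * B j)
  else B j.

Definition Ti_K (i j : aff r) : U :=
  (- v) ^ (- c i j - c (tau i) j) *:
    (K j * zpow (K i) (K' i) (- c i j)
         * zpow (K (tau i)) (K' (tau i)) (- c (tau i) j)).

Definition Ti_B (i j : aff r) : U :=
  if j == i then - (K' i * B (tau i))
  else if j == tau i then - (K' (tau i) * B i)
  else if (c i j == -1) && (c (tau i) j == 0) then B j * B i - v *: (B i * B j)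
  else if (c i j == 0) && (c (tau i) j == -1) then
    B j * B (tau i) - v *: (B (tau i) * B j)
  else if (c i j == -1) && (c (tau i) j == -1) then
    qbracket v (qbracket v (B j) (B i)) (B (tau i)) - v *: (B j * K i)
  else B j.

Local Notation ar := (inord r : aff r).
Local Notation ar1 := (inord r.+1 : aff r).

Definition Tr_K (j : aff r) : U :=
  v ^ (- (c ar j + c ar1 j)) *:
    (K j * zpow (K ar * K ar1) (K' ar1 * K' ar) (- c ar j - c ar1 j)).

Definition Tr_B (j : aff r) : U :=
  if j == ar then - (v ^- 2 *: (B ar * K' ar1))
  else if j == ar1 then - (v ^- 2 *: (B ar1 * K' ar))
  else if (c ar j == -1) && (c ar1 j == 0) then
    qbracket v (qbracket v (B j) (B ar)) (B ar1) - K ar * B j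
  else if (c ar j == 0) && (c ar1 j == -1) then
    qbracket v (qbracket v (B j) (B ar1)) (B ar) - K ar1 * B j
  else if (c ar j == -1) && (c ar1 j == -1) then
    v *: qbracket 1 (qbracket 1 (qbracket v (B j) (B ar)) (B ar1))
                    (qbracket v (B ar1) (B ar))
    - qbracket 1 (B j) (qbracket (v ^+ 3) (B ar1) (B ar)) * K ar
    + v *: (B j * K ar * K ar1)
  else B j.

(* Index i : 'I_r.+1 of a symmetry, seen as an affine node. *)
Definition node (i : 'I_r.+1) : aff r := inord i.

Definition T_K (i : 'I_r.+1) : aff r -> U :=
  if i == 0%N :> nat then T0_K else if (i < r)%N then Ti_K (node i) else Tr_K.
Definition T_B (i : 'I_r.+1) : aff r -> U :=
  if i == 0%N :> nat then T0_B else if (i < r)%N then Ti_B (node i) else Tr_B.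

(* The values at the K' j are forced, as K' j is the inverse of K j. *)
Definition is_symmetry (i : 'I_r.+1) (f : {lrmorphism U -> U}) : Prop :=
  [/\ bijective f, forall j, f (K j) = T_K i j & forall j, f (B j) = T_B i j].

End Symmetries.

(* Endomorphisms of the lattice with basis (alpha i), i : aff r, are encoded by
   their matrices acting on column vectors, so that the product of matrices is
   the composition of endomorphisms. *)
Section WeylGroup.
Variable r : nat.
Local Notation lattice := 'cV[int]_((2 * r).+1).
Local Notation c := (@cartan r).

Definition alpha (i : aff r) : lattice := delta_mx i ord0.
Definition delta : lattice := \sum_i alpha i.

Definition on_basis (f : aff r -> lattice) : 'M[int]_((2 * r).+1) :=
  \matrix_(a, j) f j a ord0.

Definition refl (i : aff r) := on_basis (fun j => alpha j - c i j *: alpha i).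

(* <omega_k, alpha_j>; the value at j = 0 is the one at alpha_0 modulo delta,
   i.e. at minus the sum of the alpha_j for j != 0. *)
Definition pairing (k j : aff r) : int :=
  if j == ord0 then -1 else (j == k)%:R.

Definition transl (k : aff r) :=
  on_basis (fun j => alpha j - pairing k j *: delta).

Definition varpi (k : aff r) : 'M[int]_((2 * r).+1) :=
  transl k *m transl (tau k).

Definition rgen (i : 'I_r.+1) : 'M[int]_((2 * r).+1) :=
  if i == 0%N :> nat then refl ord0
  else if (i < r)%N then refl (node i) *m refl (tau (node i))
  else refl (inord r) *m refl (inord r.+1) *m refl (inord r).

Definition wprod (s : seq 'I_r.+1) : 'M[int]_((2 * r).+1) :=
  \big[mulmx/1%:M]_(i <- s) rgen i.

Definition reduced_expr (w : 'M[int]_((2 * r).+1)) (s : seq 'I_r.+1) : Prop :=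
  wprod s = w /\
  forall s' : seq 'I_r.+1, wprod s' = w -> (size s <= size s')%N.

Definition is_order (w : 'M[int]_((2 * r).+1)) (m : nat) : Prop :=
  [/\ (0 < m)%N, w ^+ m = 1
    & forall l : nat, (0 < l < m)%N -> w ^+ l <> 1].

End WeylGroup.

Section BraidGroupAction.
Variable r : nat.
Local Notation U := (iqaff r).
Implicit Types (T : 'I_r.+1 -> {lrmorphism U -> U}) (s : seq 'I_r.+1).

Fixpoint Tcomp T s : U -> U :=
  if s is i :: s' then T i \o Tcomp T s' else idfun.

(* i j i j ... with m letters *)
Fixpoint alternating (i j : 'I_r.+1) (m : nat) : seq 'I_r.+1 :=
  if m is m'.+1 then i :: alternating j i m' else [::].

Definition braid_relations T : Prop :=
  forall (i j : 'I_r.+1) (m : nat), i != j -> is_order (rgen i *m rgen j) m ->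
    Tcomp T (alternating i j m) =1 Tcomp T (alternating j i m).

(* f is T_w: w has a reduced expression, and each of them yields f. *)
Definition is_Tw T (w : 'M[int]_((2 * r).+1)) (f : U -> U) : Prop :=
  (exists s, reduced_expr w s) /\
  (forall s, reduced_expr w s -> Tcomp T s =1 f).

(* 0, 1, ..., r-1, r, r-1, ..., k *)
Definition updown_word (k : nat) : seq 'I_r.+1 :=
  [seq inord i | i <- iota 0 r.+1 ++ rev (iota k (r - k))].

End BraidGroupAction.

(* Main.v *)
(* W_tau is realized by the (2r+1)-periodic bijections f of Z with
   f(1 - x) = 1 - f(x): the node i < r exchanges i and i+1 (and -i and 1-i), the
   node r exchanges r and r+2.  Such an f fixes r+1, so matrices are compared
   with bijections through weights wt(x) such that wt(r+1) = 0 and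
   wt(x+1) - wt(x) = alpha_(x mod 2r+1).  Say that i is an ascent of w when
   f(i) < f(i+1).  If i is an ascent of w but not of r_j w, then r_j w = w r_i;
   this is Bourbaki's characterization of Coxeter groups (Lie IV, 1.7), and it
   yields the exchange property, then Matsumoto's theorem: T_w does not depend
   on the reduced expression.  The bijection of the word 0, 1, .., r, .., k maps
   y to y+1 for 1 <= y < k, maps k to 1 + (2r+1) and fixes k+1, .., r+1.  Its
   k-th power is the translation varpi_k, and every letter of the k-th power of
   the word is an ascent of what precedes it, so that power is reduced. *)
Require Import Defs.
From mathcomp Require Import all_boot all_order all_algebra.
From mathcomp Require Import zify ring.

Set Implicit Arguments.
Unset Strict Implicit.
Unset Printing Implicit Defensive.

Import Order.TTheory GRing.Theory Num.Theory.
Local Open Scope ring_scope.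

Local Notation period r := ((2 * r).+1%:Z).

(** Remainders run from 1 to the period, not from 0, so that the mirror symmetry x -> 1 - x becomes
    y -> 2r + 2 - y and preserves the window. *)
Lemma windowP (r : nat) (x : int) :
  exists q y : int, [/\ x = q * period r + y, 1 <= y & y <= period r].
Proof.
exists ((x - 1) %/ period r)%Z, (((x - 1) %% period r)%Z + 1).
have := divz_eq (x - 1) (period r).
have := @ltz_pmod (x - 1) (period r) isT.
have := @modz_ge0 (x - 1) (period r) isT.
by split; lia.
Qed.

Lemma window_inj (r : nat) (q q' y y' : int) :
  1 <= y <= period r -> 1 <= y' <= period r ->
  q * period r + y = q' * period r + y' -> q = q' /\ y = y'.
Proof.
move=> hy hy' e.
have qq : q = q' by nia.
by split=> //; move: e; rewrite qq => /addrI.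
Qed.

(** * Periodic odd permutations of the integers *)

Section AffinePermutations.
Variable r : nat.
Hypothesis r_gt0 : (0 < r)%N.
Local Notation N := (period r).

(** Displacement of a window element. For j < r the second alternative of each test is the mirror
    image of an exchange of j and j + 1; for j = 0 only [N] and 1 lie in the window, and both are
    moved out of it. *)
Definition shift (j : nat) (y : int) : int :=
  if (j < r)%N then
    if (y == j%:Z) || (y == N - j%:Z) then 1
    else if (y == j%:Z + 1) || (y == N + 1 - j%:Z) then -1 else 0
  else if y == r%:Z then 2 else if y == r%:Z + 2 then -2 else 0.

Lemma shiftP (j : nat) (y : int) :
     ((j < r)%N /\ ((y = j%:Z \/ y = N - j%:Z) /\ shift j y = 1
        \/ (y = j%:Z + 1 \/ y = N + 1 - j%:Z) /\ shift j y = -1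
        \/ (y <> j%:Z /\ y <> N - j%:Z /\ y <> j%:Z + 1 /\ y <> N + 1 - j%:Z)
           /\ shift j y = 0))
  \/ ((r <= j)%N /\ (y = r%:Z /\ shift j y = 2
        \/ y = r%:Z + 2 /\ shift j y = -2
        \/ (y <> r%:Z /\ y <> r%:Z + 2) /\ shift j y = 0)).
Proof. by rewrite /shift; repeat case: ifP; lia. Qed.

Definition rperm (j : nat) (x : int) : int :=
  x + shift j (((x - 1) %% N)%Z + 1).

Lemma rperm_window j (q y : int) : 1 <= y <= N ->
  rperm j (q * N + y) = q * N + (y + shift j y).
Proof.
move=> hy; have e : q * N + y - 1 = q * N + (y - 1) by ring.
by rewrite /rperm e modzMDl modz_small ?subrK ?addrA //; lia.
Qed.

Lemma rperm_small j (y : int) : 1 <= y <= N -> rperm j y = y + shift j y.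
Proof. by move=> hy; have := rperm_window j 0 hy; rewrite !mul0r !add0r. Qed.

Lemma rpermD j (q x : int) : rperm j (q * N + x) = q * N + rperm j x.
Proof.
have [q' [y [-> y1 yN]]] := windowP r x.
by rewrite addrA -mulrDl !rperm_window ?y1 //; ring.
Qed.

Lemma shiftN j (y : int) : 1 <= y <= N -> shift j (N + 1 - y) = - shift j y.
Proof. by have := shiftP j y; have := shiftP j (N + 1 - y); lia. Qed.

Lemma rpermN j (x : int) : rperm j (1 - x) = 1 - rperm j x.
Proof.
have [q [y [-> y1 yN]]] := windowP r x.
have -> : 1 - (q * N + y) = (- q - 1) * N + (N + 1 - y) by ring.
by rewrite !rperm_window ?shiftN; try lia; ring.
Qed.

Lemma rpermK j : involutive (rperm j).
Proof.
move=> x; have [q [y [-> y1 yN]]] := windowP r x.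
rewrite rperm_window ?y1 // rpermD; congr (_ + _).
have yP := shiftP j y.
(* For j = 0 the displaced point can leave the window at either end and has to be brought back by a
   period. *)
have [ys1|ys1] := ltP (y + shift j y) 1.
  have -> : y + shift j y = -1 * N + (N + y + shift j y) by ring.
  by rewrite rperm_window; have := shiftP j (N + y + shift j y); lia.
have [ysN|ysN] := ltP N (y + shift j y).
  have -> : y + shift j y = 1 * N + (y + shift j y - N) by ring.
  by rewrite rperm_window; have := shiftP j (y + shift j y - N); lia.
by rewrite rperm_small; have := shiftP j (y + shift j y); lia.
Qed.

Definition act (s : seq 'I_r.+1) (x : int) : int :=
  foldr (fun i : 'I_r.+1 => rperm i) x s.

Lemma act_cat s t x : act (s ++ t) x = act s (act t x).
Proof. exact: foldr_cat. Qed.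

Lemma act_rcons s i x : act (rcons s i) x = act s (rperm i x).
Proof. by rewrite -cats1 act_cat. Qed.

Lemma actD s (q x : int) : act s (q * N + x) = q * N + act s x.
Proof. by elim: s => //= i s ->; rewrite rpermD. Qed.

Lemma actN s (x : int) : act s (1 - x) = 1 - act s x.
Proof. by elim: s => //= i s ->; rewrite rpermN. Qed.

Lemma act_inj s : injective (act s).
Proof. by elim: s => //= i s IH x y /(can_inj (rpermK i))/IH. Qed.

(** Modulo [N], the point r + 1 is its own mirror image, so oddness and periodicity determine its
    value. *)
Lemma act_fix s : act s (r%:Z + 1) = r%:Z + 1.
Proof.
have := actN s (r%:Z + 1).
have -> : 1 - (r%:Z + 1) = -1 * N + (r%:Z + 1) by lia.
by rewrite actD; lia.
Qed.

(** The mirror y -> N + 1 - y carries the points r + 2, .., N to 1, .., r, and the value at r + 1 is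
    forced. *)
Lemma eq_periodic_odd (f g : int -> int) :
  (forall q x, f (q * N + x) = q * N + f x) ->
  (forall x, f (1 - x) = 1 - f x) ->
  (forall q x, g (q * N + x) = q * N + g x) ->
  (forall x, g (1 - x) = 1 - g x) ->
  (forall y : int, 1 <= y <= r%:Z -> f y = g y) -> f =1 g.
Proof.
move=> fD fN gD gN fg x; have [q [y [-> y1 yN]]] := windowP r x.
rewrite fD gD; congr (_ + _).
have [yr|yr] := leP y r%:Z; first by apply: fg; rewrite y1.
have refl_y h : (forall q x, h (q * N + x) = q * N + h x) ->
    (forall x, h (1 - x) = 1 - h x) -> h y = N + 1 - h (N + 1 - y).
  move=> hD hN; have -> : N + 1 - y = 1 * N + (1 - y) by ring.
  by rewrite hD hN; ring.
rewrite refl_y // [RHS]refl_y //.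
have [yr'|yr'] := leP (N + 1 - y) r%:Z; first by rewrite fg // yr' andbT; lia.
have yE : y = N + 1 - y by lia.
by have := refl_y f fD fN; have := refl_y g gD gN; rewrite -yE; lia.
Qed.

Lemma rperm_up (i : nat) : (i < r)%N -> rperm i (i%:Z + 1) = i%:Z.
Proof. by move=> ir; rewrite rperm_small; have := shiftP i (i%:Z + 1); lia. Qed.

Lemma rperm_down (i : nat) : (i < r)%N -> rperm i i%:Z = i%:Z + 1.
Proof. by move=> ir; rewrite -[in RHS](rpermK i (i%:Z + 1)) rperm_up. Qed.

Lemma rperm_top : rperm r r%:Z = r%:Z + 2.
Proof. by rewrite rperm_small; have := shiftP r r; lia. Qed.

Lemma rperm_id (i : nat) (x : int) : (i <= r)%N -> 1 <= x <= r%:Z ->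
  x <> i%:Z -> x <> i%:Z + 1 -> rperm i x = x.
Proof. by move=> *; rewrite rperm_small; have := shiftP i x; lia. Qed.

(** After this split, linear arithmetic can treat the product d * N as an unknown. *)
Lemma mul_period_cases (d : int) : d <= -1 /\ d * N <= - N \/ d * N = 0
  \/ d * N = N \/ 2 <= d /\ 2 * N <= d * N.
Proof.
have [dn|[->|[->|dp]]] : d <= -1 \/ d = 0 \/ d = 1 \/ 2 <= d by lia.
- by left; split=> //; nia.
- by right; left; rewrite mul0r.
- by right; right; left; rewrite mul1r.
- by right; right; right; split=> //; nia.
Qed.

(** Points move by at most 2, so only close pairs can be inverted: neighbours for j < r, pairs among
    r, r + 1, r + 2 otherwise. *)
Lemma rperm_inversion (j : nat) (a b : int) :
  a < b -> rperm j b <= rperm j a ->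
  exists q y : int, [/\ 1 <= y <= N, a = q * N + y
    & (j < r)%N /\ (y = j%:Z \/ y = N - j%:Z) /\ b = a + 1
      \/ (r <= j)%N /\ (y = r%:Z /\ (b = a + 1 \/ b = a + 2)
                        \/ y = r%:Z + 1 /\ b = a + 1)].
Proof.
have [q [y [-> y1 yN]]] := windowP r a.
have [q' [y' [-> y'1 y'N]]] := windowP r b.
rewrite !rperm_window ?y1 ?y'1 // => ab ba; exists q, y; split; rewrite ?y1 //.
have := mul_period_cases (q' - q); rewrite mulrBl; move: ab ba.
have := shiftP j y; have := shiftP j y'.
by move: (q * N) (q' * N) => Q Q'; lia.
Qed.

Lemma act_window_inj s (m x x' : int) : act s x = m * N + act s x' ->
  - N < x - x' -> x - x' < N -> x = x'.
Proof.
rewrite -actD => /act_inj -> lo hi.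
by have := mul_period_cases m; move: (m * N) lo hi => Q; lia.
Qed.

(* As act s fixes r + 1, for i = r this says act s r < act s (r + 2). *)
Definition asc (s : seq 'I_r.+1) (i : 'I_r.+1) : bool :=
  act s i%:Z < act s (i%:Z + 1).

Lemma asc_nil i : asc [::] i.
Proof. by rewrite /asc /= ltrDl. Qed.

Lemma asc_rcons s i : asc s i -> ~~ asc (rcons s i) i.
Proof.
rewrite /asc !act_rcons -leNgt => lt.
have [ir|ir] := ltnP i r.
  by rewrite rperm_up // rperm_down // ltW.
have iE : i = r :> nat by have := ltn_ord i; lia.
rewrite iE in lt *.
have -> : rperm r (r%:Z + 1) = r%:Z + 1.
  by rewrite rperm_small; have := shiftP r (r%:Z + 1); lia.
(* As r + 2 is the mirror image of r, a value at r below r + 1 means a value at r + 2 above r +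
   1. *)
have -> : rperm r r%:Z = 1 * N + (1 - r%:Z) by rewrite rperm_top; lia.
by rewrite actD actN act_fix in lt *; lia.
Qed.

(** If j inverts the images of i and i + 1, then conjugation by [act s] carries the generator i to
    the generator j; this is checked on 1, .., r. *)
Lemma asc_exchange s i j : asc s i -> ~~ asc (j :: s) i ->
  act (j :: s) =1 act (rcons s i).
Proof.
have ir := ltn_ord i; rewrite /asc -leNgt /= => ab /(rperm_inversion ab).
case=> q [y [yN fiE [[jr [yE fi1E]]|[rj yE]]]].
(* If i = r, the image of i + 1 is the fixed point r + 1, so that of i is r, which a generator j < r
   does not exchange with r + 1. *)
- have {}ir : (i < r)%N.
    rewrite ltnNge; apply/negP => ri; have iE : i = r :> nat by lia.
    move: fi1E; rewrite fiE iE act_fix => e.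
    by have [] := @window_inj r q 0 y r; lia.
  have fjE : rperm j (act s i%:Z) = act s (i%:Z + 1).
    by rewrite fi1E fiE rperm_window //; have := shiftP j y; lia.
  apply: eq_periodic_odd; [exact: actD|exact: actN|exact: actD|exact: actN|].
  move=> x xr; rewrite act_rcons /=.
  have [->|/eqP xi] := eqVneq x i%:Z; first by rewrite rperm_down.
  have [->|/eqP xi1] := eqVneq x (i%:Z + 1).
    by rewrite rperm_up // -fjE rpermK.
  rewrite [rperm i x]rperm_id //; last by lia.
  have [q' [y' [fxE y'1 y'N]]] := windowP r (act s x).
  rewrite fxE rperm_window ?y'1 //; congr (_ + _).
  have fNi : act s (- i%:Z) = 1 - act s (i%:Z + 1).
    by rewrite -actN; congr act; ring.
  have fNi1 := actN s i%:Z.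
  (* The residues moved by j are those of the images of i, i + 1 and their mirrors; by injectivity
     the image of any other x is not moved. *)
  have mv : y' <> y /\ y' <> N - y /\ y' <> y + 1 /\ y' <> N + 1 - y.
    split; [|split; [|split]] => y'E.
    - by have := @act_window_inj s (q' - q) x i; lia.
    - by have := @act_window_inj s (q' + q + 1) x (- i%:Z); lia.
    - by have := @act_window_inj s (q' - q) x (i%:Z + 1); lia.
    - by have := @act_window_inj s (q' + q + 1) x (1 - i%:Z); lia.
  by have := shiftP j y'; lia.
have jE : j = r :> nat by have := ltn_ord j; lia.
have fr := act_fix s.
case: yE => [[yE [fi1E|fi1E]]|[yE fi1E]].
- have iE : i = r :> nat.
    by have := @act_window_inj s q (i%:Z + 1) (r%:Z + 1); lia.
  have {}fiE : act s r = r by rewrite iE fr in fi1E; lia.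
  apply: eq_periodic_odd; [exact: actD|exact: actN|exact: actD|exact: actN|].
  move=> x xr; rewrite act_rcons /= jE iE.
  have [->|/eqP xi] := eqVneq x r%:Z.
    rewrite fiE rperm_top; have -> : r%:Z + 2 = 1 * N + (1 - r%:Z) by ring.
    by rewrite actD actN fiE.
  rewrite [rperm r x]rperm_id //; last by lia.
  have [q' [y' [fxE y'1 y'N]]] := windowP r (act s x).
  rewrite fxE rperm_window ?y'1 //; congr (_ + _).
  have fNr := actN s r.
  have mv : y' <> r /\ y' <> r%:Z + 2.
    split=> y'E.
    - by have := @act_window_inj s q' x r; lia.
    - by have := @act_window_inj s (q' + 1) x (1 - r%:Z); lia.
  by have := shiftP r y'; lia.
(* The images of i and i + 1 would be mirror to each other, making 2 i an odd multiple of the odd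
   number [N]. *)
- have e : act s (i%:Z + 1) = act s ((2 * q + 1) * N + (1 - i%:Z)).
    by rewrite actD actN; lia.
  by have := act_inj e; lia.
- by have := @act_window_inj s q i (r%:Z + 1); lia.
Qed.

End AffinePermutations.

(** * Weights *)

Section Lattice.
Variable r : nat.
Hypothesis r_gt0 : (0 < r)%N.
Local Notation N := (period r).
Local Notation lattice := 'cV[int]_((2 * r).+1).
Local Notation aff := 'I_(2 * r).+1.

(* The coefficient of alpha a is the signed number of integers m congruent to a
   modulo 2r + 1 with r + 1 <= m < x. *)
Definition wt (x : int) : lattice :=
  \col_a (((x - a%:Z + (2 * r)%:Z) %/ N)%Z - (a <= r)%N%:Z).

(** Both ends are allowed, since the generator 0 sends 1 to 0. *)
Lemma wt_window (q y : int) (a : aff) : 0 <= y <= N ->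
  wt (q * N + y) a ord0 =
  q + (a%:Z < y)%R%:Z - (a <= r)%N%:Z.
Proof.
move=> hy; rewrite mxE; congr (_ - _); have aN := ltn_ord a.
have -> : q * N + y - a%:Z + (2 * r)%:Z = q * N + (y - a%:Z + (2 * r)%:Z).
  by ring.
rewrite divzMDl //; congr (_ + _); have [ay|ya] := ltP a%:Z y.
  have -> : y - a%:Z + (2 * r)%:Z = 1 * N + (y - a%:Z - 1) by ring.
  by rewrite divzMDl // divz_small //; lia.
by rewrite divz_small //; lia.
Qed.

Lemma wt_inj : injective wt.
Proof.
move=> x x'; have [q [y [-> y1 yN]]] := windowP r x.
have [q' [y' [-> y'1 y'N]]] := windowP r x'.
move=> /matrixP e.
have ea (a : nat) : (a < (2 * r).+1)%N ->
    q + (a%:Z < y)%R%:Z = q' + (a%:Z < y')%R%:Z.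
  move=> ha; have := e (Ordinal ha) ord0.
  by rewrite !wt_window //=; [move=> /addIr|lia|lia].
(* Coordinate 0 determines q because y and y' are positive; the coordinate at the smaller of y and
   y' then separates them. *)
have qq : q = q' by have := ea 0%N isT; lia.
have [yy'|y'y|->] := ltgtP y y'; last by rewrite qq.
- by have := ea `|y|%N; lia.
- by have := ea `|y'|%N; lia.
Qed.

(** * Reflections and translations in coordinates *)

Lemma on_basisE (f : aff -> lattice) (X : lattice) :
  on_basis f *m X = \sum_j X j ord0 *: f j.
Proof.
apply/matrixP => a b; rewrite !mxE summxE; apply: eq_bigr => j _.
by rewrite !mxE !ord1 mulrC.
Qed.

Lemma sum_alpha (X : lattice) : \sum_j X j ord0 *: alpha j = X.
Proof.
apply/matrixP => a b; rewrite summxE (bigD1 a) //= big1 ?addr0 => [|j ja].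
  by rewrite !mxE !ord1 !eqxx mulr1.
by rewrite !mxE eq_sym (negPf ja) mulr0.
Qed.

Lemma delta_coord (a : aff) : (delta r) a ord0 = 1.
Proof.
rewrite summxE (bigD1 a) //= mxE !eqxx big1 ?addr0 // => i /negPf ia.
by rewrite mxE eq_sym ia.
Qed.

Lemma transl_coord (l : aff) (X : lattice) (a : aff) : l != ord0 ->
  (transl l *m X) a ord0 = X a ord0 - (X l ord0 - X ord0 ord0).
Proof.
move=> l0; rewrite on_basisE; under eq_bigr => j _ do rewrite scalerBr scalerA.
have subZ (c : int) (V Y : lattice) :
  (Y - c *: V) a ord0 = Y a ord0 - c * V a ord0 by rewrite !mxE.
rewrite sumrB sum_alpha -scaler_suml subZ delta_coord mulr1; congr (_ - _).
rewrite (bigD1 ord0) //= (bigD1 l) //= big1 => [|j /andP[j0 jl]].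
  by rewrite /pairing eqxx (negPf l0) eqxx mulrN1 mulr1 addr0 addrC.
by rewrite /pairing (negPf j0) (negPf jl) mulr0.
Qed.

Lemma ordSP (i : aff) : i = (2 * r)%N :> nat /\ ordS i = 0%N :> nat
  \/ (i < 2 * r)%N /\ ordS i = i.+1 :> nat.
Proof.
have iN := ltn_ord i; have [ir|ir] := ltnP i (2 * r).
  by right; split; rewrite //= modn_small.
by left; rewrite /= (_ : i.+1 = (2 * r).+1) ?modnn; lia.
Qed.

Lemma ord_predP (i : aff) : i = 0%N :> nat /\ ord_pred i = (2 * r)%N :> nat
  \/ (0 < i)%N /\ ord_pred i = i.-1 :> nat.
Proof.
have iN := ltn_ord i; have [i0|i_gt0] := posnP i.
  by left; split=> //=; rewrite modn_small; lia.
right; split=> //=.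
have -> : ((i + (2 * r).+1).-1 = i.-1 + (2 * r).+1)%N by lia.
by rewrite modnDr modn_small; lia.
Qed.

(** The period is at least 3, so i and its two cyclic neighbours are distinct. In this form the sums
    over j in [refl_coord] collapse. *)
Lemma cartanE (i j : aff) :
  cartan i j = (j == i)%:Z *+ 2 - (j == ordS i)%:Z - (j == ord_pred i)%:Z.
Proof.
have iN := ltn_ord i; have jN := ltn_ord j.
have iS := ordSP i; have iP := ord_predP i; have jS := ordSP j.
have -> : cartan i j = if i == j then 2 else
    if (i == ordS j) || (j == ordS i) then -1 else 0.
  rewrite /cartan -[i == ordS j](inj_eq val_inj).
  rewrite -[j == ordS i](inj_eq val_inj) /=.
  by rewrite [(i %% _)%N]modn_small // [(j %% _)%N]modn_small.
have -> : (i == ordS j) = (j == ord_pred i).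
  by apply/eqP/eqP => /(congr1 (@nat_of_ord _)) e; apply: ord_inj; lia.
rewrite orbC eq_sym.
have SP : ordS i != ord_pred i.
  by apply/eqP => /(congr1 (@nat_of_ord _)); lia.
have SI : ordS i != i.
  by apply/eqP => /(congr1 (@nat_of_ord _)); lia.
have PI : ord_pred i != i.
  by apply/eqP => /(congr1 (@nat_of_ord _)); lia.
have [->|_] := eqVneq j i.
  by rewrite eq_sym (negPf SI) eq_sym (negPf PI).
have [->|_] := eqVneq j (ordS i); first by rewrite (negPf SP).
by case: eqP.
Qed.

Lemma refl_coord (i : aff) (X : lattice) (a : aff) :
  (refl i *m X) a ord0 =
  if a == i :> nat then X (ordS i) ord0 + X (ord_pred i) ord0 - X i ord0
  else X a ord0.
Proof.
have sum1 (k : aff) : \sum_j (j == k)%:Z * X j ord0 = X k ord0.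
  rewrite (bigD1 k) //= eqxx mul1r big1 ?addr0 // => j /negPf ->.
  by rewrite mul0r.
rewrite on_basisE; under eq_bigr => j _ do rewrite scalerBr scalerA mulrC.
rewrite sumrB sum_alpha -scaler_suml !mxE eqxx andbT.
rewrite -[a == i](inj_eq val_inj) /=.
under eq_bigr => j _ do rewrite cartanE mulrBl mulrBl mulrnAl.
rewrite !sumrB sumrMnl !sum1.
case: eqP => [/ord_inj ->|_]; first by rewrite mulr1; ring.
by rewrite mulr0 subr0.
Qed.

Lemma tau_val (i : aff) : i <> 0%N :> nat -> tau i = ((2 * r).+1 - i)%N :> nat.
Proof. by move=> i0; rewrite /tau; case: eqP => // _; rewrite inordK; lia. Qed.

(** The bridge between matrices and permutations, checked coordinate by coordinate on the indicators
    of a < y. *)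
Lemma rgen_wt (j : 'I_r.+1) (x : int) : rgen j *m wt x = wt (rperm r j x).
Proof.
have [q [y [-> y1 yN]]] := windowP r x; have jr := ltn_ord j.
apply/matrixP => a b; rewrite {b}ord1 (rperm_window r_gt0) ?y1 //.
have aN := ltn_ord a; have yP := shiftP r_gt0 j y.
have xE c : wt (q * N + y) c ord0 = q + (c%:Z < y)%R%:Z - (c <= r)%N%:Z.
  by apply: wt_window; lia.
rewrite /rgen; case: eqP => [j0|j0].
  rewrite refl_coord !xE.
  have oS := ordSP (@ord0 (2 * r)); have oP := ord_predP (@ord0 (2 * r)).
  have o0 : (@ord0 (2 * r)) = 0%N :> nat by [].
  have [yE|yE] := eqVneq y N.
    have -> : q * N + (y + shift r j y) = (q + 1) * N + 1 by lia.
    by rewrite wt_window; [case: ifP; lia|lia].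
  by rewrite wt_window; [case: ifP; lia|lia].
rewrite wt_window; last by lia.
have iE : (@node r j) = j :> nat by rewrite inordK; lia.
case: ifP => jr'.
  rewrite -mulmxA; move: (node j) iE => i iE.
  have tiE := @tau_val i; rewrite iE in tiE; have {tiE} := tiE j0.
  move: (tau i) => ti tiE.
  rewrite !refl_coord !xE; have iN := ltn_ord i; have tiN := ltn_ord ti.
  have iS := ordSP i; have iP := ord_predP i.
  have tS := ordSP ti; have tP := ord_predP ti.
  (* For 0 < j < r the two nodes are neither equal nor adjacent, so the reflections act
     independently. *)
  have -> : (ordS i == ti :> nat) = false by lia.
  have -> : (ord_pred i == ti :> nat) = false by lia.
  have -> : (i == ti :> nat) = false by lia.
  have {}iS : ordS i = i.+1 :> nat by lia.
  have {}iP : ord_pred i = i.-1 :> nat by lia.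
  have {}tP : ord_pred ti = ti.-1 :> nat by lia.
  case: eqP => ai.
    rewrite iS iP ai iE; clear tS tP.
    have -> : (j.+1 <= r)%N by lia.
    have -> : (j.-1 <= r)%N by lia.
    have -> : (j <= r)%N by lia.
    by case: yP => [[_ [|[]]]|]; lia.
  case: eqP => ati; last by clear tS tP iS iP; case: yP => [[_ [|[]]]|]; lia.
  rewrite tP ati; clear iS iP tP.
  have -> : (ti <= r)%N = false by lia.
  have -> : (ti.-1 <= r)%N = false by lia.
  case: tS => -[t2r ->].
    have -> : (0 < y) by lia.
    by case: yP => [[_ [|[]]]|]; lia.
  have -> : (ti.+1 <= r)%N = false by lia.
  by case: yP => [[_ [|[]]]|]; lia.
have iE' : (inord r : aff) = r :> nat by rewrite inordK; lia.
have iE1 : (inord r.+1 : aff) = r.+1 :> nat by rewrite inordK; lia.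
move: (inord r) (inord r.+1) iE' iE1 => i i1 {}iE i1E.
rewrite -!mulmxA !refl_coord !xE.
have iS := ordSP i; have iP := ord_predP i.
have i1S := ordSP i1; have i1P := ord_predP i1.
have -> : (ordS i == i1 :> nat) = true by lia.
have -> : (ord_pred i1 == i :> nat) = true by lia.
have -> : (ord_pred i == i1 :> nat) = false by lia.
have -> : (ord_pred i == i :> nat) = false by lia.
have -> : (ordS i1 == i :> nat) = false by lia.
have -> : (i1 == i :> nat) = false by lia.
have -> : (i == i1 :> nat) = false by lia.
rewrite eqxx.
have {}iS : ordS i = i.+1 :> nat by lia.
have {}iP : ord_pred i = i.-1 :> nat by lia.
have {}i1P : ord_pred i1 = i1.-1 :> nat by lia.
case: yP => -[ir yP]; first by lia.
case: eqP => ai.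
  rewrite iS iP ai iE i1E; clear iS iP i1P.
  have -> : (r.+1 <= r)%N = false by lia.
  have -> : (r.-1 <= r)%N by lia.
  (* The successor of r + 1 wraps around to 0 exactly when r = 1. *)
  rewrite leqnn; case: i1S => -[i1r ->].
    by case: yP => [|[]]; lia.
  have -> : (i1.+1 <= r)%N = false by lia.
  by case: yP => [|[]]; lia.
case: eqP => ai1; last by clear iS iP i1S i1P; case: yP => [|[]]; lia.
rewrite iS iP ai1 iE i1E; clear iS iP i1P.
have -> : (r.+1 <= r)%N = false by lia.
have -> : (r.-1 <= r)%N by lia.
rewrite leqnn; case: i1S => -[i1r ->].
  by case: yP => [|[]]; lia.
have -> : (i1.+1 <= r)%N = false by lia.
by case: yP => [|[]]; lia.
Qed.
End Lattice.

(** * Exchange property *)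

Section Realization.
Variable r : nat.
Hypothesis r_gt0 : (0 < r)%N.
Local Notation N := (period r).
Implicit Types (s t u : seq 'I_r.+1) (i j : 'I_r.+1).

(** The weights span the lattice: each simple root is a difference of consecutive weights. *)
Lemma eq_mulmx_wt (M M' : 'M[int]_((2 * r).+1)) :
  (forall x, M *m wt r x = M' *m wt r x) -> M = M'.
Proof.
move=> e; suff ea a : col a M = col a M'.
  by apply/matrixP => a b; have /matrixP/(_ a ord0) := ea b; rewrite !mxE.
have aN := ltn_ord a.
suff alphaE : delta_mx a ord0 = wt r (a%:Z + 1) - wt r a%:Z.
  by rewrite !colE alphaE !mulmxBr !e.
apply/matrixP => b c; rewrite (ord1 c); have bN := ltn_ord b.
have wtE (y : int) : 0 <= y <= N ->
    wt r y b ord0 = (b%:Z < y)%R%:Z - (b <= r)%N%:Z.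
  by move/(wt_window r_gt0 0 b); rewrite mul0r !add0r.
rewrite [RHS]mxE [(- wt r a%:Z)%R b ord0]mxE !wtE; try lia.
rewrite mxE eqxx andbT -(inj_eq val_inj) /=.
by case: (ltngtP b a) => ba; lia.
Qed.

Lemma wprod_cons i s : wprod (i :: s) = rgen i *m wprod s.
Proof. exact: big_cons. Qed.

Lemma wprod_cat s t : wprod (s ++ t) = wprod s *m wprod t.
Proof.
elim: s => [|i s IH]; first by rewrite /wprod big_nil mul1mx.
by rewrite cat_cons !wprod_cons IH mulmxA.
Qed.

Lemma wprod_rcons s i : wprod (rcons s i) = wprod s *m rgen i.
Proof. by rewrite -cats1 wprod_cat wprod_cons /wprod big_nil mulmx1. Qed.

Lemma wprod_wt s (x : int) : wprod s *m wt r x = wt r (act s x).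
Proof.
elim: s => [|i s IH] /=; first by rewrite /wprod big_nil mul1mx.
by rewrite wprod_cons -mulmxA IH rgen_wt.
Qed.

Lemma wprodP s t : wprod s = wprod t <-> act s =1 act t.
Proof.
split=> [e x|e]; first by apply: (wt_inj r_gt0); rewrite -!wprod_wt e.
by apply: eq_mulmx_wt => x; rewrite !wprod_wt e.
Qed.

Lemma rgenK i : rgen i *m rgen i = 1%:M.
Proof.
by apply: eq_mulmx_wt => x; rewrite -mulmxA !rgen_wt // rpermK // mul1mx.
Qed.

Lemma rgen_canr i (M M' : 'M[int]_((2 * r).+1)) :
  M *m rgen i = M' *m rgen i -> M = M'.
Proof.
by move/(congr1 (mulmx^~ (rgen i))); rewrite -!mulmxA !rgenK !mulmx1.
Qed.

Lemma wprod_canl s (M M' : 'M[int]_((2 * r).+1)) :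
  wprod s *m M = wprod s *m M' -> M = M'.
Proof.
elim: s M M' => [|i s IH] M M'; first by rewrite /wprod big_nil !mul1mx.
rewrite wprod_cons -!mulmxA => /(congr1 (mulmx (rgen i))).
by rewrite !mulmxA !rgenK !mul1mx => /IH.
Qed.

Lemma eq_asc s t i : wprod s = wprod t -> asc s i = asc t i.
Proof. by move/wprodP=> e; rewrite /asc !e. Qed.

Lemma asc_cons_wprod s i j : asc s i -> ~~ asc (j :: s) i ->
  wprod (j :: s) = wprod (rcons s i).
Proof. by move=> si jsi; apply/wprodP; exact: asc_exchange. Qed.

Definition reduced s := reduced_expr (wprod s) s.

(** Put the letters of u in front of s one at a time: the letter at which i stops being an ascent
    can be traded for a final i. *)
Lemma exchange s u i : asc s i -> ~~ asc (u ++ s) i ->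
  exists2 u', size u = (size u').+1 & wprod (u ++ s) = wprod (u' ++ rcons s i).
Proof.
move=> si; elim: u => [|j u IH] /=; first by rewrite si.
have [usi jusi|usi jusi] := boolP (asc (u ++ s) i).
  exists u => //; by rewrite (asc_cons_wprod usi jusi) rcons_cat.
have [u' -> e] := IH usi; exists (j :: u') => //=.
by rewrite !wprod_cons e.
Qed.

(** Every word t for this product has i as a descent, so by exchange it can be made to end in i at
    equal length; dropping that i leaves a word for s. *)
Lemma reduced_rcons s i : reduced s -> asc s i -> reduced (rcons s i).
Proof.
move=> [_ smin] si; split=> // t e.
have : ~~ asc t i by rewrite (eq_asc _ e) asc_rcons.
rewrite -[t]cats0 => /(exchange (asc_nil i))[u tu].
rewrite !cats0 cats1 e !wprod_rcons => /rgen_canr/esym/smin us.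
by rewrite tu size_rcons ltnS.
Qed.

Lemma reduced_belast s i : reduced (rcons s i) -> reduced s.
Proof.
move=> [_ smin]; split=> // t et; have := smin (rcons t i).
by rewrite !wprod_rcons et !size_rcons ltnS; exact.
Qed.

Lemma asc_reduced s i : reduced (rcons s i) -> asc s i.
Proof.
move=> [_ smin]; apply/negPn/negP.
rewrite -[s]cats0 => /(exchange (asc_nil i))[u su e].
have /smin : wprod u = wprod (rcons s i).
  rewrite cats0 cats1 in e.
  by rewrite wprod_rcons e wprod_rcons -mulmxA rgenK mulmx1.
by rewrite size_rcons su ltnNge leqW.
Qed.

(** * Alternating words and pairs of descents *)

Lemma alternating_rcons i j n :
  alternating i j n.+1 = rcons (alternating i j n) (if odd n then j else i).
Proof.
elim: n i j => [|n IH] i j //.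
rewrite [alternating _ _ n.+2]/= -[j :: _]/(alternating j i n.+1) IH /=.
by case: (odd n).
Qed.

Lemma size_alternating i j n : size (alternating i j n) = n.
Proof. by elim: n i j => //= n IH i j; rewrite IH. Qed.

Lemma rev_alternating i j n :
  rev (alternating i j n) =
  if odd n then alternating i j n else alternating j i n.
Proof.
elim: n i j => [|n IH] i j //.
rewrite [X in rev X = _]/= rev_cons IH /=.
rewrite -[i :: _]/(alternating i j n.+1) -[j :: _]/(alternating j i n.+1).
by rewrite !alternating_rcons; case: (odd n).
Qed.

(** Reversed so that i is the last letter, where descents are read off. *)
Local Notation ralt i j n := (rev (alternating i j n)).

Lemma raltS i j n : ralt i j n.+1 = rcons (ralt j i n) i.
Proof. exact: rev_cons. Qed.

(** The word grows on its left. The letter that destroys the ascent j is traded for a final j, which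
    produces the other alternating word of the same length. *)
Lemma desc_ralt i j n : ~~ asc (ralt i j n) j ->
  exists2 l, (0 < l <= n)%N & wprod (ralt i j l) = wprod (ralt j i l).
Proof.
elim: n => [|n IH]; first by rewrite asc_nil.
have [aij|naij _] := boolP (asc (ralt i j n) j); last first.
  have [l /andP[l0 ln] e] := IH naij; exists l => //; rewrite l0; exact: leqW.
move=> naij; exists n.+1; first by rewrite ltnS leqnn.
rewrite [in RHS]raltS.
move: naij; rewrite alternating_rcons rev_rcons => naij.
exact: asc_cons_wprod.
Qed.

Lemma mul_exprC (R : pzRingType) (a b : R) n :
  b * (a * b) ^+ n = (b * a) ^+ n * b.
Proof.
elim: n => [|n IH]; first by rewrite mulr1 mul1r.
by rewrite exprSr mulrA IH exprSr !mulrA.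
Qed.

(** Hence the two alternating words of length n agree exactly when the n-th power is 1. *)
Lemma wprod_ralt_mul i j n :
  wprod (ralt i j n) *m (rgen i *m rgen j) ^+ n = wprod (ralt j i n).
Proof.
elim: n i j => [|n IH] i j; first by rewrite mulmx1.
rewrite !raltS !wprod_rcons exprS -[(rgen i *m rgen j) * _]/(_ *m _).
rewrite -!mulmxA [rgen i *m (rgen i *m _)]mulmxA rgenK mul1mx.
rewrite -[wprod (ralt i j n)](IH j i) -mulmxA; congr (_ *m _).
exact: (mul_exprC (rgen i) (rgen j)).
Qed.

Lemma is_order_ralt i j m : (0 < m)%N ->
  wprod (ralt i j m) = wprod (ralt j i m) ->
  (forall l, (0 < l < m)%N -> wprod (ralt i j l) <> wprod (ralt j i l)) ->
  is_order (rgen i *m rgen j) m.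
Proof.
move=> m0 e min_m; split=> // [|l /min_m ne e1].
  by apply: (@wprod_canl (ralt i j m)); rewrite wprod_ralt_mul mulmx1 e.
by apply: ne; rewrite -(wprod_ralt_mul i j) e1 mulmx1.
Qed.

(* The exchange property turns the letters of u, one after the other, into
   letters of an alternating tail; as u is finite, this stops, and it can only
   stop when the alternating tails ending with i and with j coincide. *)
Lemma two_descents u i j n :
  (forall l, (0 < l < n)%N -> wprod (ralt i j l) <> wprod (ralt j i l)) ->
  ~~ asc (u ++ ralt i j n) i -> ~~ asc (u ++ ralt i j n) j ->
  exists v m, [/\ (0 < m)%N, (size v + m = size u + n)%N,
    wprod (v ++ ralt i j m) = wprod (u ++ ralt i j n),
    wprod (ralt i j m) = wprod (ralt j i m)
    & forall l, (0 < l < m)%N -> wprod (ralt i j l) <> wprod (ralt j i l)].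
Proof.
have [k] := ubnP (size u); elim: k => [//|k IH] in u i j n * => uk min_n ni nj.
have [/andP[n0 /eqP e]|ne] :=
    boolP ((0 < n)%N && (wprod (ralt i j n) == wprod (ralt j i n))).
  by exists u, n.
have min_n1 l : (0 < l < n.+1)%N -> wprod (ralt j i l) <> wprod (ralt i j l).
  case/andP=> l0; rewrite ltnS leq_eqVlt => /orP[/eqP ln|ln] e; last first.
    by apply: (min_n l); rewrite ?l0.
  by move: ne; rewrite -ln l0 e eqxx.
(* Otherwise [desc_ralt] would give a coincidence of length at most n. *)
have aj : asc (ralt i j n) j.
  by apply: contraT => /desc_ralt[l ln /esym]; have := min_n1 l ln.
have [u' uu'] := exchange aj nj; rewrite -raltS => e.
(* The letter j is appended to the tail, so i and j swap roles while u loses a letter. *)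
have [| |||v [m [m0 vm ev em min_m]]] := IH u' j i n.+1.
- by rewrite -uu'.
- exact: min_n1.
- by rewrite -(eq_asc _ e).
- by rewrite -(eq_asc _ e).
exists v, m; split=> //; first by rewrite vm uu' addnS.
  by rewrite wprod_cat -em -wprod_cat ev.
by move=> l lm /esym; exact: min_m.
Qed.

End Realization.

(** * Matsumoto's theorem *)

Section Matsumoto.
Variable r : nat.
Hypothesis r_gt0 : (0 < r)%N.
Variable T : 'I_r.+1 -> {lrmorphism iqaff r -> iqaff r}.
Hypothesis T_braid : braid_relations T.

Lemma Tcomp_cat s t x : Tcomp T (s ++ t) x = Tcomp T s (Tcomp T t x).
Proof. by elim: s => //= i s ->. Qed.

Lemma Tcomp_rcons s i x : Tcomp T (rcons s i) x = Tcomp T s (T i x).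
Proof. by rewrite -cats1 Tcomp_cat. Qed.

Lemma Tcomp_ralt (i j : 'I_r.+1) m : i != j -> is_order (rgen i *m rgen j) m ->
  Tcomp T (rev (alternating i j m)) =1 Tcomp T (rev (alternating j i m)).
Proof.
move=> ij om x; rewrite !rev_alternating.
by case: (odd m); rewrite (T_braid ij om).
Qed.

(** Induction on length. If the last letters i and j differ, both are descents, and s is linked to t
    through v followed by each of two equal alternating words: the ends share a last letter, the
    middle is a braid relation. *)
Lemma Tcomp_reduced s t : reduced s -> reduced t -> wprod s = wprod t ->
  Tcomp T s =1 Tcomp T t.
Proof.
move: {2}(size s) (erefl (size s)) => n; elim: n => [|n IH] in s t *.
  move=> /size0nil -> _ [_ tmin] e x.
  by have := tmin [::] e; rewrite leqn0 => /eqP/size0nil ->.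
case/lastP: s => [//|s i]; rewrite size_rcons => -[sn] rs rt e.
have ts : size t = n.+1.
  apply/eqP; rewrite eqn_leq -sn -(size_rcons s i).
  by case: rs rt => [_ smin] [_ tmin]; rewrite tmin // smin.
case/lastP: t => [//|t j] in rt e ts *; move: ts; rewrite size_rcons => -[tn].
have [ij|ij] := eqVneq i j.
  move=> x; rewrite !Tcomp_rcons -ij.
  apply: (IH _ _ sn (reduced_belast rs) (reduced_belast rt)).
  by move: e; rewrite -ij !wprod_rcons => /(rgen_canr r_gt0).
have desc_i := asc_rcons r_gt0 (asc_reduced r_gt0 rs).
have desc_j := asc_rcons r_gt0 (asc_reduced r_gt0 rt).
rewrite -(eq_asc r_gt0 _ e) in desc_j.
have [//|||v [m [m0 vm ev em min_m]]] :=
    @two_descents r r_gt0 (rcons s i) i j 0.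
- by case.
- by rewrite cats0.
- by rewrite cats0.
have om := is_order_ralt r_gt0 m0 em min_m.
rewrite cats0 in ev.
case: m => // m in m0 vm ev em min_m om.
have pre u k l w : size u = n -> reduced (rcons u k) ->
    wprod (rcons u k) = wprod (w ++ rev (alternating k l m.+1)) ->
    (size w + m)%N = n ->
    Tcomp T (rcons u k) =1 Tcomp T (w ++ rev (alternating k l m.+1)).
  move=> un ru; rewrite raltS -rcons_cat => eu wn x.
  rewrite !Tcomp_rcons; apply: (IH _ _ un (reduced_belast ru)); last first.
    by move: eu; rewrite !wprod_rcons => /(rgen_canr r_gt0).
  (* This word is reduced, having the product and the length of the reduced word [rcons u k]. *)
  apply: (@reduced_belast _ _ k); split=> // w' ew'.
  have := ru.2 w'; rewrite ew' -eu => /(_ erefl).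
  by rewrite !size_rcons un size_cat size_rev size_alternating wn.
have vmn : (size v + m)%N = n.
  by move: vm; rewrite size_rcons sn addn0 addnS => -[].
move=> x; rewrite (pre s i j v) // Tcomp_cat (Tcomp_ralt ij om) -Tcomp_cat.
by rewrite -(pre t j i v) // -e -ev !wprod_cat em.
Qed.
End Matsumoto.

(** * The translation varpi *)

Section TranslationWord.
Variable r : nat.
Hypothesis r_gt0 : (0 < r)%N.
Local Notation N := (period r).
Local Notation lattice := 'cV[int]_((2 * r).+1).
Local Notation aff := 'I_(2 * r).+1.
Implicit Types (s t u : seq 'I_r.+1).

Definition up (n : nat) : seq 'I_r.+1 := [seq inord i | i <- iota 0 n].
Definition down (k : nat) : seq 'I_r.+1 :=
  [seq inord i | i <- rev (iota k (r - k))].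

Lemma updown_wordE k : updown_word r k = up r.+1 ++ down k.
Proof. exact: map_cat. Qed.

Lemma upS n : up n.+1 = rcons (up n) (inord n).
Proof. by rewrite /up -map_rcons -cats1 -(iotaD 0 n 1) addn1. Qed.

Lemma downS k : (k < r)%N -> down k = rcons (down k.+1) (inord k).
Proof.
move=> kr; have -> : down k = map inord (rev (iota k (r - k.+1).+1)).
  by rewrite /down -subSn.
by rewrite /= rev_cons map_rcons.
Qed.

(** The alternative y = n admits y = 0 for n = 0, which the induction reaches from y = 1. *)
Lemma act_up n (y : int) : (n <= r)%N -> 1 <= y <= r%:Z \/ y = n%:Z ->
  y < n%:Z /\ act (up n) y = y + 1 \/ y = n%:Z /\ act (up n) y = 0
  \/ n%:Z < y /\ act (up n) y = y.
Proof.
elim: n y => [|n IH] y nr hy; first by rewrite /=; lia.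
rewrite upS act_rcons inordK; last by lia.
have [->|/eqP yn1] := eqVneq y (n%:Z + 1).
  by rewrite rperm_up //; have := IH n%:Z; lia.
have [->|/eqP yn] := eqVneq y n%:Z.
  by rewrite rperm_down //; have := IH (n%:Z + 1); lia.
by rewrite rperm_id //; have := IH y; lia.
Qed.

Lemma act_down k (y : int) : (0 < k <= r)%N -> 1 <= y <= r%:Z ->
  y < k%:Z /\ act (down k) y = y \/ y = k%:Z /\ act (down k) y = r%:Z
  \/ k%:Z < y /\ act (down k) y = y - 1.
Proof.
move=> /andP[k0 kr] hy; move: {2}(r - k)%N (erefl (r - k)%N) => d rk.
elim: d => [|d IH] in k y k0 kr hy rk *.
  by rewrite /down rk /=; lia.
have kr' : (k < r)%N by lia.
rewrite downS // act_rcons inordK; last by lia.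
have [->|/eqP yn1] := eqVneq y (k%:Z + 1).
  by rewrite rperm_up //; have := IH k.+1 k%:Z; lia.
have [->|/eqP yn] := eqVneq y k%:Z.
  by rewrite rperm_down //; have := IH k.+1 (k%:Z + 1); lia.
by rewrite rperm_id //; have := IH k.+1 y; lia.
Qed.

Lemma act_updown k (y : int) : (0 < k <= r)%N -> 1 <= y <= r%:Z ->
  y < k%:Z /\ act (updown_word r k) y = y + 1
  \/ y = k%:Z /\ act (updown_word r k) y = N + 1
  \/ k%:Z < y /\ act (updown_word r k) y = y.
Proof.
move=> hk hy; rewrite updown_wordE act_cat upS act_rcons inordK //.
(* Only y = k is carried to r. The letter r sends it to N + (1 - r), and by oddness [up r] maps 1 -
   r to 1. *)
have [zE|zr] := eqVneq (act (down k) y) r%:Z.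
  rewrite zE rperm_top //; have -> : r%:Z + 2 = 1 * N + (1 - r%:Z) by ring.
  rewrite actD // actN //; have := @act_up r r%:Z (leqnn r).
  by have := act_down hk hy; lia.
move: zr (act_down hk hy); move: (act (down k) y) => z /eqP zr zP.
rewrite rperm_id //; try lia.
by have := @act_up r z (leqnn r); lia.
Qed.

Section Powers.
Variable k : nat.
Hypothesis k_range : (0 < k <= r)%N.

Definition updown_pow (m : nat) : seq 'I_r.+1 :=
  flatten (nseq m (updown_word r k)).

Lemma updown_powSr m : updown_pow m.+1 = updown_pow m ++ updown_word r k.
Proof. by rewrite /updown_pow -[m.+1]addn1 nseqD flatten_cat /= cats0. Qed.

(** A point y <= k climbs by one at each step and enters the next window after k; as m <= k, it does
    so at most once. *)
Lemma act_updown_pow m (y : int) : (m <= k)%N -> 1 <= y <= r%:Z ->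
  y + m%:Z <= k%:Z /\ act (updown_pow m) y = y + m%:Z
  \/ y <= k%:Z /\ k%:Z < y + m%:Z
     /\ act (updown_pow m) y = N + (y + m%:Z - k%:Z)
  \/ k%:Z < y /\ act (updown_pow m) y = y.
Proof.
move=> mk hy; elim: m mk => [|m IH] mk; first by rewrite /=; lia.
rewrite act_cat.
have [[ym ->]|[[yk [ym ->]]|[ky ->]]] := IH (ltnW mk).
- by have := @act_updown k (y + m%:Z) k_range; lia.
- have -> : N + (y + m%:Z - k%:Z) = 1 * N + (y + m%:Z - k%:Z) by ring.
  by rewrite actD //; have := @act_updown k (y + m%:Z - k%:Z) k_range; lia.
- by have := @act_updown k y k_range; lia.
Qed.

Lemma act_updown_pow_full (y : int) : 1 <= y <= N ->
  y <= k%:Z /\ act (updown_pow k) y = N + y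
  \/ N - k%:Z < y /\ act (updown_pow k) y = y - N
  \/ (k%:Z < y /\ y <= N - k%:Z) /\ act (updown_pow k) y = y.
Proof.
move=> hy; have [yr|yr] := leP y r%:Z.
  by have := @act_updown_pow k y (leqnn k); lia.
have [->|/eqP yr1] := eqVneq y (r%:Z + 1); first by rewrite act_fix //; lia.
have -> : y = 1 * N + (1 - (N + 1 - y)) by ring.
rewrite actD // actN //.
by have := @act_updown_pow k (N + 1 - y) (leqnn k); lia.
Qed.

Lemma reduced_updown_pow m : (m <= k)%N -> reduced (updown_pow m).
Proof.
elim: m => [|m IH] mk; first by split.
have {}IH := IH (ltnW mk); rewrite updown_powSr.
have pP y := @act_updown_pow m y (ltnW mk).
move: (updown_pow m) IH pP => p IH pP.
have p1 : act p 1 = 1 + m%:Z by have := pP 1; lia.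
have p0 : act p 0 = - m%:Z.
  by rewrite -(subrr 1) actN // p1; lia.
(* The letter n is an ascent: n goes to 0 and then to - m, while n + 1 has a positive image. *)
have red_up n : (n <= r.+1)%N -> reduced (p ++ up n).
  elim: n => [|n IHn] nr; first by rewrite cats0.
  rewrite upS -rcons_cat; apply: reduced_rcons => //; first exact/IHn/ltnW.
  rewrite /asc inordK // !act_cat.
  have upn : act (up n) n%:Z = 0 by have := @act_up n n%:Z; lia.
  rewrite upn p0; have [nr'|nr'] := ltnP n r.
    have -> : act (up n) (n%:Z + 1) = n%:Z + 1.
      by have := @act_up n (n%:Z + 1); lia.
    by have := pP (n%:Z + 1); lia.
  have -> : n = r by lia.
  by rewrite !act_fix //; lia.
(* In the descending half, the letter j compares j + 1, fixed by p since j >= k, with N + 1 + m. *)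
suff red_down d j : (r - j)%N = d -> (k <= j <= r)%N ->
    reduced (p ++ updown_word r j).
  by apply: (red_down _ k erefl); lia.
elim: d j => [|d IHd] j rj /andP[kj jr].
  rewrite updown_wordE /down rj cats0; exact: red_up.
have jr' : (j < r)%N by lia.
rewrite updown_wordE downS // -!rcons_cat -updown_wordE.
apply: reduced_rcons => //; first by apply: IHd; lia.
rewrite /asc inordK; last by lia.
rewrite !act_cat.
have -> : act (updown_word r j.+1) j%:Z = j%:Z + 1.
  by have := @act_updown j.+1 j%:Z; lia.
have -> : act (updown_word r j.+1) (j%:Z + 1) = 1 * N + 1.
  by have := @act_updown j.+1 (j%:Z + 1); lia.
rewrite actD // p1.
by have := pP (j%:Z + 1); lia.
Qed.

(** Both sides add to the weight X a multiple of delta. Its coefficient 2 X_0 - X_k - X_(tau k) is 1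
    for y <= k, -1 for y > N - k and 0 in between. *)
Lemma varpiE : varpi (inord k : aff) = wprod (updown_pow k).
Proof.
apply: (eq_mulmx_wt r_gt0) => x; rewrite (wprod_wt r_gt0).
have [q [y [-> y1 yN]]] := windowP r x.
have kE : (inord k : aff) = k :> nat by rewrite inordK; lia.
have kn0 : (inord k : aff) != ord0 by rewrite -(inj_eq val_inj) /= kE; lia.
have tkE : tau (inord k : aff) = ((2 * r).+1 - k)%N :> nat.
  by have := tau_val r_gt0 (i := inord k); rewrite kE; apply; lia.
have tkn0 : tau (inord k : aff) != ord0.
  by rewrite -(inj_eq val_inj) /= tkE; lia.
rewrite actD //; apply/matrixP => a b; rewrite {b}ord1.
rewrite /varpi -mulmxA !transl_coord //.
have o0 : @ord0 (2 * r) = 0%N :> nat by [].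
have yr : 1 <= y <= N by rewrite y1.
have [[yk ->]|[[yk ->]|[yk ->]]] := act_updown_pow_full yr.
- have -> : q * N + (N + y) = (q + 1) * N + y by ring.
  by rewrite !wt_window ?kE ?tkE //; lia.
- have -> : q * N + (y - N) = (q - 1) * N + y by ring.
  by rewrite !wt_window ?kE ?tkE //; lia.
- by rewrite !wt_window ?kE ?tkE //; lia.
Qed.

End Powers.
End TranslationWord.

Lemma iter_Tcomp (r : nat)
    (T : 'I_r.+1 -> {lrmorphism iqaff r -> iqaff r}) s n :
  iter n (Tcomp T s) =1 Tcomp T (flatten (nseq n s)).
Proof. by move=> x; elim: n => //= n ->; rewrite Tcomp_cat. Qed.

Theorem proposition2p8 (r : nat) (r_ge1 : (1 <= r)%N)
    (T : 'I_r.+1 -> {lrmorphism iqaff r -> iqaff r})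
    (T_symmetry : forall i : 'I_r.+1, is_symmetry i (T i))
    (T_braid : braid_relations T)
    (k : nat) (k_range : (1 <= k <= r)%N) :
  is_Tw T (varpi (inord k : aff r)) (iter k (Tcomp T (updown_word r k))).
Proof.
have red := reduced_updown_pow r_ge1 k_range (leqnn k).
have varpi_k := varpiE r_ge1 k_range.
split=> [|s]; first by exists (updown_pow r k k); rewrite varpi_k.
case=> ws smin x; rewrite iter_Tcomp; move: x.
have red_s : reduced s by split=> // t; rewrite ws; exact: smin.
by apply: Tcomp_reduced => //; rewrite ws varpi_k.
Qed.
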